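(* Let $n$ be odd, $h=\frac1{n+1}$, let $a,c\in C^0([0,1]^2)$ with $a>0$ and $c\ge 0$, and let $A=\bar L_h$ be the matrix of the scheme for $-\nabla\cdot(a\nabla u)+cu=f$ on $(0,1)^2$ with Dirichlet boundary conditions described in the context. Suppose that: (i) for every cell center $(x_i,y_j)$, $$\frac{(a_{i-1,j}+4 a_{i,j}+9a_{i+1,j})(3a_{i-1,j}+a_{i+1,j})}{4 (a_{i-1,j}+a_{i+1,j}+a_{i,j+1}+a_{i,j-1}+h^2c_{i,j})}>3 a_{i-1,j}-4a_{i,j}+3a_{i+1,j}$$ and $$\frac{(a_{i,j-1}+4 a_{i,j}+9a_{i,j+1})(3a_{i,j-1}+a_{i,j+1})}{4 (a_{i,j-1}+a_{i,j+1}+a_{i+1,j}+a_{i-1,j}+h^2c_{i,j})}>3 a_{i,j-1}-4a_{i,j}+3a_{i,j+1};$$ (ii) for every (interior) edge center $(x_i,y_j)$ of an edge parallel to the $x$-axis, $$\frac{2(a_{i-1,j}+4 a_{i,j}+9a_{i+1,j})(3a_{i-1,j}+a_{i+1,j})}{(a_{i,j-2}+4a_{i,j-1}+18 a_{i,j}+4a_{i,j+1}+a_{i,j+2})+8(a_{i-1,j}+a_{i+1,j})+8c_{i,j}h^2}> 3 a_{i-1,j}-4a_{i,j}+3a_{i+1,j};$$ (iii) for every (interior) edge center $(x_i,y_j)$ of an edge parallel to the $y$-axis, $$\frac{2(a_{i,j-1}+4 a_{i,j}+9a_{i,j+1})(3a_{i,j-1}+a_{i,j+1})}{(a_{i-2,j}+4a_{i-1,j}+18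 a_{i,j}+4a_{i+1,j}+a_{i+2,j})+8(a_{i,j-1}+a_{i,j+1})+8c_{i,j}h^2}> 3 a_{i,j-1}-4a_{i,j}+3a_{i,j+1}.$$ Then $A^{-1}\ge 0$ (i.e. $A$ is invertible and all entries of $A^{-1}$ are nonnegative).
   Context: Matrix inequalities are entrywise. Grid: $n$ odd, $h=\frac{1}{n+1}$, $x_i=ih$, $y_j=jh$, $0\le i,j\le n+1$. Write $a_{i,j}=a(x_i,y_j)$, $c_{i,j}=c(x_i,y_j)$. The finite element cells are $[x_{2k},x_{2k+2}]\times[y_{2l},y_{2l+2}]$. An interior grid point ($1\le i,j\le n$) is: a cell center if $i,j$ are both odd; a knot if $i,j$ are both even; an edge center of an edge parallel to the $y$-axis if $i$ is even and $j$ is odd; an edge center of an edge parallel to the $x$-axis if $i$ is odd and $j$ is even. For a grid function $\bar{\mathbf u}=(u_{i,j})_{0\le i,j\le n+1}$ put $$C^x(\bar{\mathbf u})_{i,j}=\frac{-(3a_{i-1,j}+a_{i+1,j})u_{i-1,j}+4(a_{i-1,j}+a_{i+1,j})u_{i,j}-(a_{i-1,j}+3a_{i+1,j})u_{i+1,j}}{4h^2},$$ $$E^x(\bar{\mathbf u})_{i,j}=\frac{1}{8h^2}\Big[(3a_{i-2,j}-4a_{i-1,j}+3a_{i,j})u_{i-2,j}-(4a_{i-2,j}+12a_{i,j})u_{i-1,j}+(a_{i-2,j}+4a_{i-1,j}+18a_{i,j}+4a_{i+1,j}+a_{i+2,j})u_{i,j}-(12a_{i,j}+4a_{i+2,j})u_{i+1,j}+(3a_{i+2,j}-4a_{i+1,j}+3a_{i,j})u_{i+2,j}\Big],$$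 and let $C^y,E^y$ be the same expressions with the roles of the two indices exchanged (shifts in $j$ instead of $i$). The linear operator $\mathcal L_h$ of the scheme (the finite difference implementation of the $C^0$-$Q^2$ finite element method with $3\times 3$ Gauss-Lobatto quadrature) is: $\mathcal L_h(\bar{\mathbf u})_{i,j}=u_{i,j}$ at boundary grid points, and at interior points - cell center: $C^x(\bar{\mathbf u})_{i,j}+C^y(\bar{\mathbf u})_{i,j}+c_{i,j}u_{i,j}$; - knot: $E^x(\bar{\mathbf u})_{i,j}+E^y(\bar{\mathbf u})_{i,j}+c_{i,j}u_{i,j}$; - edge center, edge parallel to $y$-axis: $E^x(\bar{\mathbf u})_{i,j}+C^y(\bar{\mathbf u})_{i,j}+c_{i,j}u_{i,j}$; - edge center, edge parallel to $x$-axis: $C^x(\bar{\mathbf u})_{i,j}+E^y(\bar{\mathbf u})_{i,j}+c_{i,j}u_{i,j}$. $\bar L_h$ is the $(n+2)^2\times(n+2)^2$ matrix representing $\mathcal L_h$ (rows and columns indexed by all grid points, including boundary points). *)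

(* Defs.v *)
From HB Require Import structures.
From mathcomp Require Import all_boot all_order all_algebra.
From mathcomp Require Import all_classical all_reals all_analysis.
From mathcomp Require Import ring.

Set Implicit Arguments.
Unset Strict Implicit.
Unset Printing Implicit Defensive.

Import Order.TTheory GRing.Theory Num.Theory.
Import numFieldNormedType.Exports.

Local Open Scope classical_set_scope.
Local Open Scope ring_scope.

Definition unit_square (R : realType) : set (R * R) := `[0, 1] `*` `[0, 1].
Arguments unit_square : clear implicits.

Definition mesh (R : realType) (n : nat) : R := 1 / n.+1%:R.

(* [nodal n f i j] is f_{i,j} = f(x_i, y_j). *)
Definition nodal (R : realType) (n : nat) (f : R * R -> R) (i j : nat) : R :=
  f (i%:R * mesh R n, j%:R * mesh R n).

Definition interior_node (n i j : nat) : bool :=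
  [&& 0 < i, i <= n, 0 < j & j <= n]%N.

Definition cell_center (n i j : nat) : bool :=
  [&& interior_node n i j, odd i & odd j].
Definition knot (n i j : nat) : bool :=
  [&& interior_node n i j, ~~ odd i & ~~ odd j].
Definition edge_center_x (n i j : nat) : bool :=
  [&& interior_node n i j, odd i & ~~ odd j].
Definition edge_center_y (n i j : nat) : bool :=
  [&& interior_node n i j, ~~ odd i & odd j].

(* One-dimensional stencils along a grid line.  Subtraction on indices is
   truncated, but [stencilC] is only used with 1 <= i and [stencilE] only
   with 2 <= i, where the truncation never occurs. *)
Definition stencilC (R : realType) (h : R) (a u : nat -> R) (i : nat) : R :=
  (- (3 * a (i - 1)%N + a (i + 1)%N) * u (i - 1)%N
   + 4 * (a (i - 1)%N + a (i + 1)%N) * u i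
   - (a (i - 1)%N + 3 * a (i + 1)%N) * u (i + 1)%N) / (4 * h ^+ 2).

Definition stencilE (R : realType) (h : R) (a u : nat -> R) (i : nat) : R :=
  1 / (8 * h ^+ 2) *
  ((3 * a (i - 2)%N - 4 * a (i - 1)%N + 3 * a i) * u (i - 2)%N
   - (4 * a (i - 2)%N + 12 * a i) * u (i - 1)%N
   + (a (i - 2)%N + 4 * a (i - 1)%N + 18 * a i
      + 4 * a (i + 1)%N + a (i + 2)%N) * u i
   - (12 * a i + 4 * a (i + 2)%N) * u (i + 1)%N
   + (3 * a (i + 2)%N - 4 * a (i + 1)%N + 3 * a i) * u (i + 2)%N).

Section Scheme.
Variables (R : realType) (n : nat) (a c : R * R -> R).
Let h := mesh R n.

(* A grid function (u_{i,j}), 0 <= i, j <= n+1, is a matrix whose row index i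
   is the x-index and whose column index j is the y-index.  [gval u i j] reads
   it with natural number indices; it is only meaningful for i, j <= n+1. *)
Definition gval (u : 'M[R]_n.+2) (i j : nat) : R := u (inord i) (inord j).

Definition Cx (u : 'M[R]_n.+2) (i j : nat) : R :=
  stencilC h (fun k => nodal n a k j) (fun k => gval u k j) i.
Definition Cy (u : 'M[R]_n.+2) (i j : nat) : R :=
  stencilC h (fun k => nodal n a i k) (fun k => gval u i k) j.
Definition Ex (u : 'M[R]_n.+2) (i j : nat) : R :=
  stencilE h (fun k => nodal n a k j) (fun k => gval u k j) i.
Definition Ey (u : 'M[R]_n.+2) (i j : nat) : R :=
  stencilE h (fun k => nodal n a i k) (fun k => gval u i k) j.

Definition scheme_op (u : 'M[R]_n.+2) : 'M[R]_n.+2 :=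
  \matrix_(i, j)
    if cell_center n i j then Cx u i j + Cy u i j + nodal n c i j * u i j
    else if knot n i j then Ex u i j + Ey u i j + nodal n c i j * u i j
    else if edge_center_y n i j then
      Ex u i j + Cy u i j + nodal n c i j * u i j
    else if edge_center_x n i j then
      Cx u i j + Ey u i j + nodal n c i j * u i j
    else u i j.

(* [lin_mx] represents an operator acting on row vectors from the right; the
   transpose is the usual matrix, acting on the column vector of the values
   of u at all (n+2)^2 grid points (see [scheme_mxE]). *)
Definition scheme_mx : 'M[R]_(n.+2 * n.+2) := (lin_mx scheme_op)^T.

Lemma scheme_op_is_linear : linear scheme_op.
Proof.
move=> k u v; apply/matrixP => i j.
rewrite !mxE /Cx /Cy /Ex /Ey /stencilC /stencilE /gval !mxE.
by do 4?case: ifP => _; rewrite // ; ring.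
Qed.

HB.instance Definition _ :=
  GRing.isLinear.Build R 'M[R]_n.+2 'M[R]_n.+2 *:%R scheme_op
    scheme_op_is_linear.

Lemma scheme_mxE (u : 'M[R]_n.+2) :
  scheme_mx *m (mxvec u)^T = (mxvec (scheme_op u))^T.
Proof. by rewrite /scheme_mx -trmx_mul mul_vec_lin. Qed.

End Scheme.

(* Main.v *)
(* Since a matrix A with A u >= 0 ==> u >= 0 has a nonnegative inverse, it
   suffices to show that L_h u >= 0 forces u >= 0.  Otherwise subtract the
   negative minimum: v = u - min u is nonnegative, positive on the boundary,
   vanishes somewhere in the interior and still satisfies L_h v >= 0, because
   c >= 0 and the stencils annihilate constants.  The only off-diagonal entries
   that may be positive join points at distance two along a grid line whose
   middle point has an odd index.  The inequality at that middle point bounds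
   v there from below by the values at both ends, and conditions (i)-(iii) say
   exactly enough for this bound to absorb the positive entry.  Doing this
   first at edge centers (using cell centers) and then at knots (using edge
   centers) makes every v_{i,j} dominate a positive multiple of v_{i',j} with
   i' = i - 1 or i - 2, so positivity propagates from the side x = 0 and v > 0
   in the interior, a contradiction. *)
Require Import Defs.
From mathcomp Require Import all_boot all_order all_algebra.
From mathcomp Require Import all_classical all_reals all_analysis.
From mathcomp Require Import ring lra zify.

Set Implicit Arguments.
Unset Strict Implicit.
Unset Printing Implicit Defensive.

Import Order.TTheory GRing.Theory Num.Theory.
Import numFieldNormedType.Exports.

Local Open Scope classical_set_scope.
Local Open Scope ring_scope.

(** * One-dimensional stencils and discrete supersolutions *)

Definition stencil (R : realType) (h : R) (a v : nat -> R) (i : nat) : R :=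
  if odd i then stencilC h a v i else stencilE h a v i.

(* The coefficient of the central value in [4 * h ^+ 2 * stencil h a v i]. *)
Definition stencil_diag (R : realType) (a : nat -> R) (i : nat) : R :=
  if odd i then 4 * (a (i - 1)%N + a (i + 1)%N)
  else (a (i - 2)%N + 4 * a (i - 1)%N + 18 * a i
        + 4 * a (i + 1)%N + a (i + 2)%N) / 2.

Definition op_diag (R : realType) (h : R) (a c : nat -> nat -> R)
    (i j : nat) : R :=
  stencil_diag (a ^~ j) i + stencil_diag (a i) j + 4 * h ^+ 2 * c i j.

(* Each of conditions (i)-(iii) implies this one for [T] the diagonal entry times
   [4 * h ^+ 2]; unlike them, it is invariant under reversal of the grid line. *)
Definition line_gap (R : realType) (a : nat -> R) (i : nat) (T : R) : Prop :=
  (3 * a (i - 1)%N - 4 * a i + 3 * a (i + 1)%N) * T <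
    4 * (a (i - 1)%N + 3 * a (i + 1)%N) * (3 * a (i - 1)%N + a (i + 1)%N).

(* The inequality of an odd index once the transverse stencil is bounded by its
   diagonal term; [T] is as in [line_gap]. *)
Definition odd_lower (R : realType) (a v : nat -> R) (i : nat) (T : R) : Prop :=
  (3 * a (i - 1)%N + a (i + 1)%N) * v (i - 1)%N
  + (a (i - 1)%N + 3 * a (i + 1)%N) * v (i + 1)%N <= T * v i.

(** Models [u - min u]. The fields are symmetric in the two axes, so an estimate along one axis
    transfers to the other by [supersolutionC]; strict positivity on the boundary is kept apart. *)
Record supersolution (R : realType) (n : nat) (h : R)
    (a c v : nat -> nat -> R) : Prop := {
  sup_odd : odd n;
  sup_h : 0 < h;
  sup_a : forall i j, (i <= n.+1)%N -> (j <= n.+1)%N -> 0 < a i j;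
  sup_c : forall i j, (i <= n.+1)%N -> (j <= n.+1)%N -> 0 <= c i j;
  sup_v : forall i j, (i <= n.+1)%N -> (j <= n.+1)%N -> 0 <= v i j;
  sup_op : forall i j, interior_node n i j ->
    0 <= stencil h (a ^~ j) (v ^~ j) i + stencil h (a i) (v i) j + c i j * v i j;
  sup_gapx : forall i j, interior_node n i j -> odd i ->
    line_gap (a ^~ j) i (op_diag h a c i j);
  sup_gapy : forall i j, interior_node n i j -> odd j ->
    line_gap (a i) j (op_diag h a c i j) }.

Lemma interior_nodeC (n i j : nat) : interior_node n i j = interior_node n j i.
Proof. by rewrite /interior_node; lia. Qed.

Lemma op_diagC (R : realType) (h : R) (a c : nat -> nat -> R) (i j : nat) :
  op_diag h (fun i j => a j i) (fun i j => c j i) i j = op_diag h a c j i.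
Proof. by rewrite /op_diag [in LHS](addrC (stencil_diag _ _)). Qed.

Lemma supersolutionC (R : realType) (n : nat) (h : R) (a c v : nat -> nat -> R) :
  supersolution n h a c v ->
  supersolution n h (fun i j => a j i) (fun i j => c j i) (fun i j => v j i).
Proof.
move=> S; split.
- exact: sup_odd S.
- exact: sup_h S.
- by move=> i j hi hj; exact: (sup_a S).
- by move=> i j hi hj; exact: (sup_c S).
- by move=> i j hi hj; exact: (sup_v S).
- move=> i j; rewrite interior_nodeC => hI.
  by rewrite [stencil _ _ _ i + _]addrC; exact: (sup_op S hI).
- by move=> i j; rewrite interior_nodeC op_diagC => hI oi; exact: (sup_gapy S hI oi).
- by move=> i j; rewrite interior_nodeC op_diagC => hI oj; exact: (sup_gapx S hI oj).
Qed.

(** * Estimates along a single grid line *)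

Lemma stencilC_scale (R : realType) (h : R) (a v : nat -> R) (i : nat) :
  0 < h ->
  4 * h ^+ 2 * stencilC h a v i =
  4 * (a (i - 1)%N + a (i + 1)%N) * v i
  - ((3 * a (i - 1)%N + a (i + 1)%N) * v (i - 1)%N
     + (a (i - 1)%N + 3 * a (i + 1)%N) * v (i + 1)%N).
Proof. by move=> h0; rewrite /stencilC; field; rewrite lt0r_neq0. Qed.

(** Neighbours are grouped by side: each group is half of a difference that [gap_absorb] makes
    nonpositive. *)
Lemma stencilE_scale (R : realType) (h : R) (a v : nat -> R) (i : nat) :
  0 < h ->
  4 * h ^+ 2 * stencilE h a v i =
  (a (i - 2)%N + 4 * a (i - 1)%N + 18 * a i
        + 4 * a (i + 1)%N + a (i + 2)%N) / 2 * v i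
  + ((3 * a (i - 2)%N - 4 * a (i - 1)%N + 3 * a i) * v (i - 2)%N
     - 4 * (a (i - 2)%N + 3 * a i) * v (i - 1)%N) / 2
  + ((3 * a (i + 2)%N - 4 * a (i + 1)%N + 3 * a i) * v (i + 2)%N
     - 4 * (a (i + 2)%N + 3 * a i) * v (i + 1)%N) / 2.
Proof. by move=> h0; rewrite /stencilE; field; rewrite lt0r_neq0. Qed.

(** The coefficients of either stencil sum to zero. *)
Lemma stencilB (R : realType) (h : R) (a v : nat -> R) (m : R) (i : nat) :
  stencil h a (fun k => v k - m) i = stencil h a v i.
Proof.
by rewrite /stencil /stencilC /stencilE; case: ifP => _; ring.
Qed.

(* The lower bound on the middle value [vc] absorbs the term of unknown sign
   into the neighbouring negative entry: the product of the two negative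
   entries along the path dominates the long-range entry [3p - 4m + 3q]. *)
Lemma gap_absorb (R : realType) (p m q T vl vc vr : R) :
  0 < p -> 0 < q -> 0 < T -> 0 <= vl -> 0 <= vr ->
  (3 * p - 4 * m + 3 * q) * T < 4 * (p + 3 * q) * (3 * p + q) ->
  (3 * p + q) * vl + (p + 3 * q) * vr <= T * vc ->
  (3 * p - 4 * m + 3 * q) * vl <= 4 * (p + 3 * q) * vc /\
  (0 < vl -> (3 * p - 4 * m + 3 * q) * vl < 4 * (p + 3 * q) * vc).
Proof.
set P := 3 * p - 4 * m + 3 * q => p0 q0 T0 vl0 vr0 gap lower.
have pq0 : 0 < 4 * (p + 3 * q) by lra.
have vrpq : 0 <= (p + 3 * q) * vr by apply: mulr_ge0 => //; lra.
have path : 4 * (p + 3 * q) * (3 * p + q) * vl <= 4 * (p + 3 * q) * vc * T.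
  have lo : (3 * p + q) * vl <= T * vc by lra.
  by have := ler_wpM2l (ltW pq0) lo; lra.
split=> [|vlp].
  rewrite -(ler_pM2r T0) (mulrAC _ vl); apply: le_trans path.
  exact: ler_wpM2r vl0 _ _ (ltW gap).
rewrite -(ltr_pM2r T0) (mulrAC _ vl); apply: lt_le_trans path.
by rewrite ltr_pM2r.
Qed.

(** With [P = 3p - 4m + 3q], the factor [p + 4m + 9q] equals [4(p + 3q) - P], which is below
    [4(p + 3q)] when [P > 0]; when [P <= 0] the signs alone suffice. *)
Lemma gap_of_ltr_div (R : realType) (p m q T : R) :
  0 < p -> 0 < q -> 0 < T ->
  3 * p - 4 * m + 3 * q < (p + 4 * m + 9 * q) * (3 * p + q) / T ->
  (3 * p - 4 * m + 3 * q) * T < 4 * (p + 3 * q) * (3 * p + q).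
Proof.
move=> p0 q0 T0; rewrite ltr_pdivlMr //; set P := 3 * p - 4 * m + 3 * q => ltP.
have [P0|P0] := lerP P 0.
  apply: (@le_lt_trans _ _ 0); first by rewrite mulr_le0_ge0 // ltW.
  by rewrite !mulr_gt0 //; lra.
apply: lt_trans ltP _.
have -> : p + 4 * m + 9 * q = 4 * (p + 3 * q) - P by rewrite /P; ring.
by rewrite ltr_pM2r; lra.
Qed.

Lemma stencilE_le (R : realType) (h : R) (a v : nat -> R) (i : nat) (T1 T2 : R) :
  0 < h -> (2 <= i)%N -> ~~ odd i ->
  0 < a (i - 2)%N -> 0 < a i -> 0 < a (i + 2)%N ->
  0 <= v (i - 2)%N -> 0 <= v i -> 0 <= v (i + 2)%N ->
  0 < T1 -> 0 < T2 ->
  line_gap a (i - 1) T1 -> odd_lower a v (i - 1) T1 ->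
  line_gap a (i + 1) T2 -> odd_lower a v (i + 1) T2 ->
  4 * h ^+ 2 * stencil h a v i <= stencil_diag a i * v i /\
  (0 < v (i - 2)%N -> 4 * h ^+ 2 * stencil h a v i < stencil_diag a i * v i).
Proof.
move=> h0 i2 oi a1 a2 a3 v1 v2 v3 T10 T20.
rewrite /line_gap /odd_lower !addnK -!addnA -!subnDA subnK; last exact: ltnW.
move=> g1 l1 g2 l2; rewrite /stencil /stencil_diag (negbTE oi) stencilE_scale //.
have [le1 lt1] := gap_absorb a1 a2 T10 v1 v2 g1 l1.
(* The right half is the mirror image: [gap_absorb] takes [a (i + 2)] as its [p] and [a i] as its
   [q]. *)
have g2' : (3 * a (i + 2)%N - 4 * a (i + 1)%N + 3 * a i) * T2 <
    4 * (a (i + 2)%N + 3 * a i) * (3 * a (i + 2)%N + a i) by lra.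
have l2' : (3 * a (i + 2)%N + a i) * v (i + 2)%N
    + (a (i + 2)%N + 3 * a i) * v i <= T2 * v (i + 1)%N by lra.
have [le2 _] := gap_absorb a3 a2 T20 v3 v2 g2' l2'.
by split=> [|/lt1]; lra.
Qed.

Lemma stencilC_le (R : realType) (h : R) (a v : nat -> R) (i : nat) :
  0 < h -> odd i -> 0 < a (i - 1)%N -> 0 < a (i + 1)%N ->
  0 <= v (i - 1)%N -> 0 <= v (i + 1)%N ->
  4 * h ^+ 2 * stencil h a v i <= stencil_diag a i * v i /\
  (0 < v (i - 1)%N -> 4 * h ^+ 2 * stencil h a v i < stencil_diag a i * v i).
Proof.
move=> h0 oi a1 a2 v1 v2; rewrite /stencil /stencil_diag oi stencilC_scale //.
set x := a _ in a1 *; set y := a _ in a2 *.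
have r0 : 0 <= (x + 3 * y) * v (i + 1)%N by apply: mulr_ge0; lra.
split=> [|vp].
  have l0 : 0 <= (3 * x + y) * v (i - 1)%N by apply: mulr_ge0; lra.
  lra.
have l0 : 0 < (3 * x + y) * v (i - 1)%N by apply: mulr_gt0; lra.
lra.
Qed.

(** [i + 1 + ~~ odd i] is the rightmost index that the stencil reaches. *)
Lemma stencil_diag_gt0 (R : realType) (a : nat -> R) (i : nat) :
  (forall k, (k <= i + 1 + ~~ odd i)%N -> 0 < a k) -> 0 < stencil_diag a i.
Proof.
move=> a0; rewrite /stencil_diag; case: ifP a0 => oi a0.
  have := a0 (i - 1)%N; have := a0 (i + 1)%N; rewrite addn0.
  move=> /(_ ltac:(lia)) ? /(_ ltac:(lia)) ?; lra.
have ai k : (k <= i + 2)%N -> 0 < a k by move=> ki; apply: a0 => /=; lia.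
have := ai (i - 2)%N ltac:(lia); have := ai (i - 1)%N ltac:(lia).
have := ai i ltac:(lia); have := ai (i + 1)%N ltac:(lia).
have := ai (i + 2)%N ltac:(lia); lra.
Qed.

Lemma op_diag_gt0 (R : realType) (n : nat) (h : R) (a c : nat -> nat -> R)
    (i j : nat) :
  odd n -> 0 < h ->
  (forall i j, (i <= n.+1)%N -> (j <= n.+1)%N -> 0 < a i j) ->
  (forall i j, (i <= n.+1)%N -> (j <= n.+1)%N -> 0 <= c i j) ->
  interior_node n i j -> 0 < op_diag h a c i j.
Proof.
move=> on h0 a0 c0 /and4P [i0 iN j0 jN]; rewrite /op_diag.
have := @stencil_diag_gt0 _ (a ^~ j) i => /(_ ltac:(move=> k ki; apply: a0; lia)).
have := @stencil_diag_gt0 _ (a i) j => /(_ ltac:(move=> k ki; apply: a0; lia)).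
have : 0 <= 4 * h ^+ 2 * c i j.
  by apply: mulr_ge0; [rewrite mulr_ge0 ?sqr_ge0 | apply: c0; lia].
lra.
Qed.

(** * Propagation of positivity across the grid *)

Section MinimumPrinciple.
Variables (R : realType) (n : nat) (h : R).
Implicit Types (a c v : nat -> nat -> R).

Lemma odd_lower_of_stencil_le a c v i j :
  supersolution n h a c v -> interior_node n i j -> odd i ->
  4 * h ^+ 2 * stencil h (a i) (v i) j <= stencil_diag (a i) j * v i j ->
  odd_lower (a ^~ j) (v ^~ j) i (op_diag h a c i j).
Proof.
move=> S hI oi; have := sup_op S hI; have h0 := sup_h S.
have h20 : 0 < 4 * h ^+ 2 by rewrite mulr_gt0 ?exprn_gt0.
rewrite -(pmulr_rge0 _ h20) !mulrDr {1}/stencil oi stencilC_scale //.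
rewrite /odd_lower /op_diag {2}/stencil_diag oi; lra.
Qed.

Lemma odd_stencil_le a c v i j :
  supersolution n h a c v -> interior_node n i j -> odd j ->
  4 * h ^+ 2 * stencil h (a i) (v i) j <= stencil_diag (a i) j * v i j.
Proof.
move=> S /and4P [i0 iN j0 jN] oj.
have [] // := stencilC_le (sup_h S) oj (a := a i) (v := v i);
  by [apply: (sup_a S); lia | apply: (sup_v S); lia].
Qed.

Lemma even_stencil_le a c v i j :
  supersolution n h a c v -> interior_node n i j -> ~~ odd j ->
  odd_lower (a i) (v i) (j - 1) (op_diag h a c i (j - 1)) ->
  odd_lower (a i) (v i) (j + 1) (op_diag h a c i (j + 1)) ->
  4 * h ^+ 2 * stencil h (a i) (v i) j <= stencil_diag (a i) j * v i j /\
  (0 < v i (j - 2)%N ->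
   4 * h ^+ 2 * stencil h (a i) (v i) j < stencil_diag (a i) j * v i j).
Proof.
move=> S /and4P [i0 iN j0 jN] oj l1 l2; have on := sup_odd S.
(* As [n] is odd, an even interior [j] satisfies [2 <= j <= n - 1], so both odd neighbours are
   interior. *)
have I1 : interior_node n i (j - 1) by rewrite /interior_node; lia.
have I2 : interior_node n i (j + 1) by rewrite /interior_node; lia.
apply: (stencilE_le (sup_h S) _ oj _ _ _ _ _ _ _ _ _ l1 _ l2);
  try by [lia | apply: (sup_a S); lia | apply: (sup_v S); lia
  | apply: (op_diag_gt0 on (sup_h S) (sup_a S) (sup_c S))
  | apply: (sup_gapy S) => //; lia].
Qed.

Lemma odd_odd_lower a c v i j :
  supersolution n h a c v -> interior_node n i j -> odd i -> odd j ->
  odd_lower (a i) (v i) j (op_diag h a c i j).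
Proof.
move=> S hI oi oj; rewrite -(op_diagC h a c j i).
have St := supersolutionC S; have hIt : interior_node n j i by rewrite interior_nodeC.
exact: (odd_lower_of_stencil_le St hIt oj (odd_stencil_le St hIt oi)).
Qed.

(** For even [j] the middle points [(i, j - 1)] and [(i, j + 1)] of the transverse stencil are cell
    centers, where [odd_odd_lower] already gives the bound. *)
Lemma odd_row_lower a c v i j :
  supersolution n h a c v -> interior_node n i j -> odd i ->
  odd_lower (a ^~ j) (v ^~ j) i (op_diag h a c i j).
Proof.
move=> S hI oi; apply: (odd_lower_of_stencil_le S) => //.
have [oj|ej] := boolP (odd j); first exact: odd_stencil_le S hI oj.
have on := sup_odd S; move: (hI) => /and4P [i0 iN j0 jN].
have I1 : interior_node n i (j - 1) by rewrite /interior_node; lia.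
have I2 : interior_node n i (j + 1) by rewrite /interior_node; lia.
have o1 : odd (j - 1) by lia.
have o2 : odd (j + 1) by lia.
by have [] := even_stencil_le S hI ej
  (odd_odd_lower S I1 oi o1) (odd_odd_lower S I2 oi o2).
Qed.

(** For even [j] the middle points may now be edge centers, covered by [odd_row_lower] with the axes
    exchanged. [j - 1 - ~~ odd j] is the leftmost index reached. *)
Lemma stencil_le a c v i j :
  supersolution n h a c v -> interior_node n i j ->
  4 * h ^+ 2 * stencil h (a i) (v i) j <= stencil_diag (a i) j * v i j /\
  (0 < v i (j - 1 - ~~ odd j)%N ->
   4 * h ^+ 2 * stencil h (a i) (v i) j < stencil_diag (a i) j * v i j).
Proof.
move=> S hI; have on := sup_odd S; move: (hI) => /and4P [i0 iN j0 jN].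
have [oj|ej] := boolP (odd j).
  rewrite subn0; apply: (stencilC_le (sup_h S) oj);
  by [apply: (sup_a S); lia | apply: (sup_v S); lia].
have I1 : interior_node n (j - 1) i by rewrite /interior_node; lia.
have I2 : interior_node n (j + 1) i by rewrite /interior_node; lia.
have o1 : odd (j - 1) by lia.
have o2 : odd (j + 1) by lia.
have l1 := odd_row_lower (supersolutionC S) I1 o1.
have l2 := odd_row_lower (supersolutionC S) I2 o2.
rewrite op_diagC in l1; rewrite op_diagC in l2.
by rewrite -subnDA; exact: even_stencil_le S hI ej l1 l2.
Qed.

Lemma supersolution_gt0 a c v :
  supersolution n h a c v ->
  (forall j, (j <= n.+1)%N -> 0 < v 0%N j) ->
  forall i j, interior_node n i j -> 0 < v i j.
Proof.
move=> S v0; elim/ltn_ind=> i IH j hI; move: (hI) => /and4P [i0 iN j0 jN].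
have on := sup_odd S; have h0 := sup_h S.
set k := (i - 1 - ~~ odd i)%N.
have vk : 0 < v k j.
  have [->|kp] := posnP k; first by apply: v0; lia.
  by apply: IH; rewrite ?/interior_node /k; lia.
have hI' : interior_node n j i by rewrite interior_nodeC.
have [_ /(_ vk) ltx] := stencil_le (supersolutionC S) hI'.
have [ley _] := stencil_le S hI.
have h20 : 0 < 4 * h ^+ 2 by rewrite mulr_gt0 ?exprn_gt0.
(* The strict bound along x and the weak one along y turn [sup_op] into
   [0 < op_diag h a c i j * v i j]. *)
have := sup_op S hI; rewrite -(pmulr_rge0 _ h20) !mulrDr => op0.
have T0 := op_diag_gt0 on h0 (sup_a S) (sup_c S) hI.
rewrite -(pmulr_rgt0 _ T0) /op_diag !mulrDl; lra.
Qed.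

End MinimumPrinciple.

(** * Nonnegativity of the inverse matrix *)

Lemma monotone_mx_inv_ge0 (R : realType) (m : nat) (A : 'M[R]_m) :
  (forall u : 'cV[R]_m, (forall k, 0 <= (A *m u) k 0) -> forall k, 0 <= u k 0) ->
  A \in unitmx /\ (forall k l, 0 <= invmx A k l).
Proof.
move=> mono; have unitA : A \in unitmx.
  rewrite -unitmx_tr -row_free_unit -kermx_eq0.
  apply/eqP/row_matrixP => i; rewrite row0; set r := row i _.
  have Ar0 : A *m r^T = 0.
    by apply: trmx_inj; rewrite trmx_mul trmxK trmx0 -row_mul mulmx_ker row0.
  (* Both [r^T] and [- r^T] have image zero, so monotonicity forces [r = 0]. *)
  apply/rowP => k; rewrite [RHS]mxE; apply/eqP; rewrite eq_le; apply/andP; split.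
    have := mono (- r^T) _ k; rewrite !mxE oppr_ge0; apply=> l.
    by rewrite mulmxN Ar0 oppr0 mxE.
  by have := mono r^T _ k; rewrite mxE; apply=> l; rewrite Ar0 mxE.
(* Column [l] of the inverse is the preimage of a basis vector. *)
split=> // k l; have := mono (invmx A *m delta_mx l 0) _ k.
rewrite -colE mxE; apply=> p.
by rewrite colE mulKVmx // mxE ler0n.
Qed.

Lemma nodal_unit_square (R : realType) (n i j : nat) :
  (i <= n.+1)%N -> (j <= n.+1)%N ->
  unit_square R (i%:R * mesh R n, j%:R * mesh R n).
Proof.
have in01 k : (k <= n.+1)%N -> k%:R * mesh R n \in `[0, 1]%R.
  move=> kn; rewrite in_itv /= /mesh mul1r divr_ge0 ?ler0n //=.
  by rewrite ler_pdivrMr ?ltr0n // mul1r ler_nat.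
by move=> /in01 hi /in01 hj; split.
Qed.

Theorem theorem4p5 (R : realType) (n : nat) (a c : R * R -> R) :
  odd n ->
  {within unit_square R, continuous a} ->
  {within unit_square R, continuous c} ->
  (forall p, unit_square R p -> 0 < a p) ->
  (forall p, unit_square R p -> 0 <= c p) ->
  let h := mesh R n in
  let a_ i j := nodal n a i j in
  let c_ i j := nodal n c i j in
  (forall i j : nat, cell_center n i j ->
     3 * a_ (i - 1)%N j - 4 * a_ i j + 3 * a_ (i + 1)%N j <
       (a_ (i - 1)%N j + 4 * a_ i j + 9 * a_ (i + 1)%N j)
         * (3 * a_ (i - 1)%N j + a_ (i + 1)%N j)
       / (4 * (a_ (i - 1)%N j + a_ (i + 1)%N j + a_ i (j + 1)%N
               + a_ i (j - 1)%N + h ^+ 2 * c_ i j))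
     /\
     3 * a_ i (j - 1)%N - 4 * a_ i j + 3 * a_ i (j + 1)%N <
       (a_ i (j - 1)%N + 4 * a_ i j + 9 * a_ i (j + 1)%N)
         * (3 * a_ i (j - 1)%N + a_ i (j + 1)%N)
       / (4 * (a_ i (j - 1)%N + a_ i (j + 1)%N + a_ (i + 1)%N j
               + a_ (i - 1)%N j + h ^+ 2 * c_ i j))) ->
  (forall i j : nat, edge_center_x n i j ->
     3 * a_ (i - 1)%N j - 4 * a_ i j + 3 * a_ (i + 1)%N j <
       2 * (a_ (i - 1)%N j + 4 * a_ i j + 9 * a_ (i + 1)%N j)
         * (3 * a_ (i - 1)%N j + a_ (i + 1)%N j)
       / ((a_ i (j - 2)%N + 4 * a_ i (j - 1)%N + 18 * a_ i j
           + 4 * a_ i (j + 1)%N + a_ i (j + 2)%N)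
          + 8 * (a_ (i - 1)%N j + a_ (i + 1)%N j) + 8 * c_ i j * h ^+ 2)) ->
  (forall i j : nat, edge_center_y n i j ->
     3 * a_ i (j - 1)%N - 4 * a_ i j + 3 * a_ i (j + 1)%N <
       2 * (a_ i (j - 1)%N + 4 * a_ i j + 9 * a_ i (j + 1)%N)
         * (3 * a_ i (j - 1)%N + a_ i (j + 1)%N)
       / ((a_ (i - 2)%N j + 4 * a_ (i - 1)%N j + 18 * a_ i j
           + 4 * a_ (i + 1)%N j + a_ (i + 2)%N j)
          + 8 * (a_ i (j - 1)%N + a_ i (j + 1)%N) + 8 * c_ i j * h ^+ 2)) ->
  scheme_mx n a c \in unitmx /\
  (forall k l, 0 <= invmx (scheme_mx n a c) k l).
Proof.
move=> on _ _ apos cpos h a_ c_ hcc hex hey.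
have h0 : 0 < h by rewrite /h /mesh divr_gt0 ?ltr0n.
have a0 i j : (i <= n.+1)%N -> (j <= n.+1)%N -> 0 < a_ i j.
  by move=> iN jN; apply: apos; exact: nodal_unit_square.
have c0 i j : (i <= n.+1)%N -> (j <= n.+1)%N -> 0 <= c_ i j.
  by move=> iN jN; apply: cpos; exact: nodal_unit_square.
(* The denominators in (ii) and (iii) are twice [op_diag], while those in (i) equal it. *)
have half (X Y D : R) : 2 * X * Y / D = X * Y / (D / 2).
  by rewrite invf_div; ring.
have gapx i j : interior_node n i j -> odd i ->
    line_gap (a_ ^~ j) i (op_diag h a_ c_ i j).
  move=> hI oi; have T0 := op_diag_gt0 on h0 a0 c0 hI.
  have /and4P [i0 iN j0 jN] := hI.
  apply: gap_of_ltr_div => //; try by apply: a0; lia.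
  have [oj|ej] := boolP (odd j).
    have [lt1 _] := hcc i j ltac:(by rewrite /cell_center hI oi oj).
    apply: lt_le_trans lt1 _; rewrite le_eqVlt; apply/predU1P; left.
    by congr (_ / _); rewrite /op_diag /stencil_diag oi oj; ring.
  have lt1 := hex i j ltac:(by rewrite /edge_center_x hI oi ej).
  rewrite half in lt1; apply: lt_le_trans lt1 _.
  rewrite le_eqVlt; apply/predU1P; left.
  by congr (_ / _); rewrite /op_diag /stencil_diag oi (negbTE ej); field.
have gapy i j : interior_node n i j -> odd j ->
    line_gap (a_ i) j (op_diag h a_ c_ i j).
  move=> hI oj; have T0 := op_diag_gt0 on h0 a0 c0 hI.
  have /and4P [i0 iN j0 jN] := hI.
  apply: gap_of_ltr_div => //; try by apply: a0; lia.
  have [oi|ei] := boolP (odd i).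
    have [_ lt1] := hcc i j ltac:(by rewrite /cell_center hI oi oj).
    apply: lt_le_trans lt1 _; rewrite le_eqVlt; apply/predU1P; left.
    by congr (_ / _); rewrite /op_diag /stencil_diag oi oj; ring.
  have lt1 := hey i j ltac:(by rewrite /edge_center_y hI oj ei).
  rewrite half in lt1; apply: lt_le_trans lt1 _.
  rewrite le_eqVlt; apply/predU1P; left.
  by congr (_ / _); rewrite /op_diag /stencil_diag oj (negbTE ei); field.
apply: monotone_mx_inv_ge0 => w; rewrite -[w]trmxK -[w^T]vec_mxK.
set U := vec_mx _; rewrite scheme_mxE => Lw.
have {Lw} LU i j : 0 <= scheme_op a c U i j.
  by have := Lw (mxvec_index i j); rewrite mxE mxvecE.
suff U0 i j : 0 <= U i j.
  by move=> k; case/mxvec_indexP: k => i j; rewrite mxE mxvecE.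
pose i0 : 'I_n.+2 := ord0.
case: (@arg_minP _ _ _ (i0, i0) xpredT (fun p => U p.1 p.2)) => // -[p q] _ minU.
set m := U p q in minU; apply: le_trans (minU (i, j) isT) => /=.
rewrite leNgt; apply/negP => m0.
(* At boundary nodes the operator is the identity. *)
have ord_out (k l : 'I_n.+2) : ~~ interior_node n k l -> 0 <= U k l.
  move=> out; have := LU k l; rewrite mxE /cell_center /knot /edge_center_y.
  by rewrite /edge_center_x (negbTE out).
pose v k l := gval U k l - m.
have S : supersolution n h a_ c_ v.
  split; [exact: on|exact: h0|exact: a0|exact: c0| | |exact: gapx|exact: gapy].
    move=> k l kN lN.
    by rewrite /v subr_ge0; exact: (minU (inord k, inord l)).
  move=> k l hI; have /and4P [k0 kN l0 lN] := hI.
  have := LU (inord k) (inord l); rewrite mxE !inordK; try lia.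
  (* Subtracting [m] alters only the zeroth-order term, which changes by [- (c_ k l * m) >= 0]. *)
  have cm : c_ k l * m <= 0 by apply: mulr_ge0_le0 (ltW m0); apply: c0; lia.
  rewrite /v !stencilB mulrBr /cell_center /knot /edge_center_y /edge_center_x hI.
  rewrite /stencil /Cx /Cy /Ex /Ey /gval -/h -/a_ -/c_.
  by case: (odd k); case: (odd l) => /= L0;
    rewrite addrA; apply: (addr_ge0 L0); rewrite oppr_ge0.
have [hI|/ord_out] := boolP (interior_node n p q); last by rewrite leNgt m0.
have v0 l : (l <= n.+1)%N -> 0 < v 0%N l.
  move=> lN; rewrite /v subr_gt0 (lt_le_trans m0) //; apply: ord_out.
  by rewrite /interior_node inordK.
by have := supersolution_gt0 S v0 hI; rewrite /v /gval !inord_val -/m subrr ltxx.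
Qed.
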